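(* Let $(a_n)_{n\ge 1}$ be a sequence of quaternions with $|a_n|<1$ for all $n\ge1$, and let $(\mathbf{\Phi}_n)_{n\ge1}$ be the slice regular Malmquist–Takenaka system generated by $(a_n)_{n\ge1}$. If $\sum_{n\ge 1}(1-|a_n|)=+\infty$, then the system $(\mathbf{\Phi}_n)_{n\ge1}$ is complete in $H^2(\mathbb{B})$; that is, if $f\in H^2(\mathbb{B})$ satisfies $\langle f,\mathbf{\Phi}_n\rangle=0$ for all $n\ge1$, then $f\equiv0$.
   Context: $\mathbb{H}$ is the skew field of quaternions with norm $|q|=\sqrt{q\overline q}$, $\mathbb{B}=\{q\in\mathbb{H}:|q|<1\}$, and $\mathbb{S}=\{q\in\mathbb{H}:q^2=-1\}$ is the sphere of imaginary units. For $I\in\mathbb{S}$, $L_I=\mathbb{R}+\mathbb{R}I$ and $\mathbb{B}_I=\mathbb{B}\cap L_I$. Slice regular functions: a function $f:\mathbb{B}\to\mathbb{H}$ is (slice) regular if for every $I\in\mathbb{S}$ its restriction $f_I$ to $\mathbb{B}_I$ has continuous partial derivatives and satisfies $\frac12\left(\frac{\partial}{\partial x}+I\frac{\partial}{\partial y}\right)f_I(x+yI)=0$; equivalently, $f(q)=\sum_{n\ge 0}q^na_n$ is a power series with coefficients $a_n\in\mathbb{H}$ converging on $\mathbb{B}$ (similarly on larger balls centered at $0$). For regular $f(q)=\sum q^na_n$, $g(q)=\sum q^nb_n$: - regular product: $(f\ast g)(q)=\sum_{n\ge 0}q^n\sum_{k=0}^na_kb_{n-k}$ (associative, generally non-commutative);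 - regular conjugate: $f^c(q)=\sum_{n\ge 0}q^n\overline{a_n}$; symmetrization: $f^s=f\ast f^c=f^c\ast f$; - regular reciprocal: $f^{-\ast}=(f^s)^{-1}f^c$ (where $f^s\neq 0$). For $a\in\mathbb{B}$ the regular Blaschke function is $\mathcal{B}_a(q)=(1-q\overline a)^{-\ast}\ast(q-a)$. Hardy space: $H^2(\mathbb{B})$ is the space of regular $f:\mathbb{B}\to\mathbb{H}$, $f(q)=\sum_{n\ge0}q^na_n$, with $\sum_{n\ge 0}|a_n|^2<\infty$, with inner product, for $g(q)=\sum_{n\ge 0} q^nb_n$, $$\langle f,g\rangle=\sum_{n\ge 0}\overline{b_n}a_n=\lim_{r\to1^-}\frac1{2\pi}\int_0^{2\pi}\overline{g(re^{I\theta})}f(re^{I\theta})\,d\theta\quad\text{for any } I\in\mathbb{S}.$$ Slice regular Malmquist–Takenaka system generated by a sequence $(a_n)_{n\ge1}$ in $\mathbb{B}$: $$\mathbf{\Phi}_1(z)=\sqrt{1-|a_1|^2}\,(1-z\overline{a_1})^{-\ast},$$ $$\mathbf{\Phi}_n(z)=\sqrt{1-|a_n|^2}\,\bigl(\mathcal{B}_{a_1}\ast\mathcal{B}_{a_2}\ast\cdots\ast\mathcal{B}_{a_{n-1}}\bigr)(z)\ast(1-z\overline{a_n})^{-\ast}\quad(n\ge2).$$ *)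

(* Defs.v *)
From HB Require Import structures.
From mathcomp Require Import all_boot all_order all_algebra.
From mathcomp Require Import ring lra.
From mathcomp Require Import all_classical all_reals all_analysis.

Set Implicit Arguments.
Unset Strict Implicit.
Unset Printing Implicit Defensive.

Import Order.TTheory GRing.Theory Num.Theory.
Import numFieldNormedType.Exports.

Local Open Scope classical_set_scope.
Local Open Scope ring_scope.

Record quat (R : Type) := Quat { qre : R; qi : R; qj : R; qk : R }.

Section QuatAlgebra.
Context {R : realType}.
Implicit Types p q r : quat R.

Let tuple_of_quat q : R * R * R * R := (qre q, qi q, qj q, qk q).
Let quat_of_tuple (t : R * R * R * R) : quat R :=
  Quat t.1.1.1 t.1.1.2 t.1.2 t.2.

Fact tuple_of_quatK : cancel tuple_of_quat quat_of_tuple.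
Proof. by case. Qed.

HB.instance Definition _ := Choice.copy (quat R) (can_type tuple_of_quatK).

Let addq p q :=
  Quat (qre p + qre q) (qi p + qi q) (qj p + qj q) (qk p + qk q).
Let oppq q := Quat (- qre q) (- qi q) (- qj q) (- qk q).
Let zeroq : quat R := Quat 0 0 0 0.

Fact addqA : associative addq.
Proof. by move=> [????] [????] [????]; congr Quat; rewrite /= addrA. Qed.
Fact addqC : commutative addq.
Proof. by move=> [????] [????]; congr Quat; rewrite /= addrC. Qed.
Fact add0q : left_id zeroq addq.
Proof. by move=> [????]; congr Quat; rewrite /= add0r. Qed.
Fact addNq : left_inverse zeroq oppq addq.
Proof. by move=> [????]; congr Quat; rewrite /= addNr. Qed.

HB.instance Definition _ :=
  GRing.isZmodule.Build (quat R) addqA addqC add0q addNq.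

Let oneq : quat R := Quat 1 0 0 0.
Let mulq p q :=
  Quat (qre p * qre q - qi p * qi q - qj p * qj q - qk p * qk q)
       (qre p * qi q + qi p * qre q + qj p * qk q - qk p * qj q)
       (qre p * qj q - qi p * qk q + qj p * qre q + qk p * qi q)
       (qre p * qk q + qi p * qj q - qj p * qi q + qk p * qre q).

Fact mulqA : associative mulq.
Proof. by move=> [????] [????] [????]; congr Quat => /=; ring. Qed.
Fact mul1q : left_id oneq mulq.
Proof. by move=> [????]; congr Quat => /=; ring. Qed.
Fact mulq1 : right_id oneq mulq.
Proof. by move=> [????]; congr Quat => /=; ring. Qed.
Fact mulqDl : left_distributive mulq +%R.
Proof. by move=> [????] [????] [????]; congr Quat => /=; ring. Qed.
Fact mulqDr : right_distributive mulq +%R.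
Proof. by move=> [????] [????] [????]; congr Quat => /=; ring. Qed.
Fact oneq_neq0 : oneq != 0.
Proof. by apply/eqP => -[/eqP]; rewrite oner_eq0. Qed.

HB.instance Definition _ := GRing.Zmodule_isNzRing.Build (quat R)
  mulqA mul1q mulq1 mulqDl mulqDr oneq_neq0.

Let scaleq (x : R) q := Quat (x * qre q) (x * qi q) (x * qj q) (x * qk q).

Fact scaleqA x y q : scaleq x (scaleq y q) = scaleq (x * y) q.
Proof. by congr Quat; rewrite /= mulrA. Qed.
Fact scale1q : left_id 1 scaleq.
Proof. by move=> [????]; congr Quat; rewrite /= mul1r. Qed.
Fact scaleqDr : right_distributive scaleq +%R.
Proof. by move=> x [????] [????]; congr Quat; rewrite /= mulrDr. Qed.
Fact scaleqDl q : {morph scaleq^~ q : x y / x + y}.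
Proof. by move=> x y; congr Quat; rewrite /= mulrDl. Qed.

HB.instance Definition _ := GRing.Zmodule_isLmodule.Build R (quat R)
  scaleqA scale1q scaleqDr scaleqDl.

Fact scaleqAl (x : R) p q : x *: (p * q) = (x *: p) * q.
Proof. by congr Quat => /=; ring. Qed.
Fact scaleqAr (x : R) p q : x *: (p * q) = p * (x *: q).
Proof. by congr Quat => /=; ring. Qed.

HB.instance Definition _ := GRing.Lmodule_isLalgebra.Build R (quat R) scaleqAl.
HB.instance Definition _ := GRing.Lalgebra_isAlgebra.Build R (quat R) scaleqAr.

Definition conjq q : quat R := Quat (qre q) (- qi q) (- qj q) (- qk q).

Definition qnorm q : R := Num.sqrt (qre (q * conjq q)).

Fact qre_mul_conjq q :
  qre (q * conjq q) = qre q ^+ 2 + qi q ^+ 2 + qj q ^+ 2 + qk q ^+ 2.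
Proof. by rewrite /=; ring. Qed.

Fact qre_mul_conjq_ge0 q : 0 <= qre (q * conjq q).
Proof. by rewrite qre_mul_conjq !addr_ge0 ?sqr_ge0. Qed.

Fact mul_conjqE q : q * conjq q = (qnorm q ^+ 2)%:A.
Proof.
rewrite sqr_sqrtr ?qre_mul_conjq_ge0//.
by case: q => a b c d; congr Quat => /=; ring.
Qed.

Fact conjq_mulE q : conjq q * q = (qnorm q ^+ 2)%:A.
Proof.
rewrite sqr_sqrtr ?qre_mul_conjq_ge0//.
by case: q => a b c d; congr Quat => /=; ring.
Qed.

Fact qnorm0_eq0 q : qnorm q = 0 -> q = 0.
Proof.
case: q => a b c d /eqP; rewrite sqrtr_eq0 qre_mul_conjq /= => q0.
have := sqr_ge0 a; have := sqr_ge0 b; have := sqr_ge0 c; have := sqr_ge0 d.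
move=> d0 c0 b0 a0; congr Quat;
  by apply/eqP; rewrite -sqrf_eq0 eq_le sqr_ge0 andbT; lra.
Qed.

Fact ler_qnormD p q : qnorm (p + q) <= qnorm p + qnorm q.
Proof.
rewrite -(@ler_pXn2r _ 2) ?nnegrE ?addr_ge0 ?sqrtr_ge0// sqrrD.
rewrite !sqr_sqrtr ?qre_mul_conjq_ge0// -sqrtrM ?qre_mul_conjq_ge0//.
set s := Num.sqrt _.
suff sE : qre p * qre q + qi p * qi q + qj p * qj q + qk p * qk q <= s.
  by rewrite !qre_mul_conjq /=; move: sE; lra.
apply: le_trans (ler_norm _) _; rewrite -sqrtr_sqr ler_sqrt.
  rewrite !qre_mul_conjq.
  case: p q {s} => [a b c d] [a' b' c' d'] /=.
  rewrite -subr_ge0 [leRHS](_ : _ = (a * b' - b * a') ^+ 2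
    + (a * c' - c * a') ^+ 2 + (a * d' - d * a') ^+ 2 + (b * c' - c * b') ^+ 2
    + (b * d' - d * b') ^+ 2 + (c * d' - d * c') ^+ 2); last by ring.
  by rewrite !addr_ge0 ?sqr_ge0.
by rewrite mulr_ge0 ?qre_mul_conjq_ge0.
Qed.

Fact qnormZ (x : R) q : qnorm (x *: q) = `|x| * qnorm q.
Proof.
rewrite -sqrtr_sqr -sqrtrM ?sqr_ge0//; congr Num.sqrt.
by rewrite !qre_mul_conjq /=; ring.
Qed.

HB.instance Definition _ := Lmodule_isNormed.Build R (quat R)
  ler_qnormD qnormZ qnorm0_eq0.

Let unitq : pred (quat R) := fun q => q != 0.
Let invq q := qnorm q ^- 2 *: conjq q.

Fact qnorm_sqr_unit q : q \in unitq -> qnorm q ^+ 2 != 0.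
Proof. by move=> q0; rewrite sqrf_eq0; apply: contra q0 => /eqP/qnorm0_eq0->. Qed.

Fact mulVq : {in unitq, left_inverse 1 invq *%R}.
Proof.
by move=> q /qnorm_sqr_unit q0; rewrite -scaleqAl conjq_mulE scalerA mulVf// scale1r.
Qed.
Fact mulqV : {in unitq, right_inverse 1 invq *%R}.
Proof.
by move=> q /qnorm_sqr_unit q0; rewrite -scaleqAr mul_conjqE scalerA mulVf// scale1r.
Qed.
Fact unitqP p q : q * p = 1 /\ p * q = 1 -> unitq p.
Proof.
by move=> [qp1 _]; apply/eqP => p0; move/eqP: qp1; rewrite p0 mulr0 eq_sym oner_eq0.
Qed.
Fact invq_out : {in [predC unitq], invq =1 id}.
Proof.
move=> q; rewrite inE negbK => /eqP ->; rewrite /invq.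
by congr Quat; rewrite /= ?oppr0 mulr0.
Qed.

HB.instance Definition _ := GRing.NzRing_hasMulInverse.Build (quat R)
  mulVq mulqV unitqP invq_out.

End QuatAlgebra.

(* A function on the unit ball is a total function [quat R -> quat R] of which
   only the values at [q] with [`|q| < 1] are meaningful. *)

Section SliceRegular.
Context {R : realType}.
Implicit Types (f g : quat R -> quat R) (a : nat -> quat R) (q I : quat R).

Definition imaginary_unit I := I ^+ 2 = -1.

Definition slice_pt I (z : R * R) : quat R := z.1%:A + z.2 *: I.

Definition slice_regular f := forall I, imaginary_unit I ->
  let fI := (fun z : R * R => f (slice_pt I z)) in
  forall z : R * R, `|slice_pt I z| < 1 ->
    [/\ derivable fI z (1, 0), derivable fI z (0, 1),
        {for z, continuous (fun w => 'D_(1, 0) fI w)},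
        {for z, continuous (fun w => 'D_(0, 1) fI w)}
      & 2^-1 *: ('D_(1, 0) fI z + I * 'D_(0, 1) fI z) = 0].

Definition power_series a q : quat R :=
  limn (series (fun n => q ^+ n * a n)).

Definition has_expansion f a := forall q, `|q| < 1 ->
  series (fun n => q ^+ n * a n) @ \oo --> f q.

(* The coefficients are determined by the values of [f] on the reals of the
   ball; a function with no expansion gets the zero sequence. *)
Definition coefs f : nat -> quat R :=
  xget (fun=> 0) [set a | has_expansion f a].

Definition rmul f g : quat R -> quat R :=
  power_series (fun n => \sum_(k < n.+1) coefs f k * coefs g (n - k)%N).

Definition rconj f : quat R -> quat R :=
  power_series (fun n => conjq (coefs f n)).

Definition rsym f : quat R -> quat R := rmul f (rconj f).

(* [rsym f] has real coefficients, so the regular product of its reciprocal with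
   [rconj f] is the pointwise one. *)
Definition rinv f : quat R -> quat R := fun q => (rsym f q)^-1 * rconj f q.

Definition blaschke (c : quat R) : quat R -> quat R :=
  rmul (rinv (fun q => 1 - q * conjq c)) (fun q => q - c).

Definition H2 f := slice_regular f /\
  exists2 a, has_expansion f a & (\sum_(n <oo) (`|a n| ^+ 2)%:E < +oo)%E.

Definition H2_inner f g : quat R :=
  limn (series (fun n => conjq (coefs g n) * coefs f n)).

Fixpoint blaschke_prod a n : quat R -> quat R :=
  if n is m.+1 then rmul (blaschke_prod a m) (blaschke (a m.+1))
  else blaschke (a 0%N).

(* Sequences are indexed from 0: [a n] and [MT a n] are the (n+1)-st terms. *)
Definition MT a n : quat R -> quat R :=
  let kernel := rinv (fun q => 1 - q * conjq (a n)) in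
  fun q => Num.sqrt (1 - `|a n| ^+ 2) *:
    (if n is m.+1 then rmul (blaschke_prod a m) kernel q else kernel q).

Definition complete_in_H2 (Phi : nat -> quat R -> quat R) :=
  forall f, H2 f -> (forall n, H2_inner f (Phi n) = 0) ->
  forall q, `|q| < 1 -> f q = 0.

End SliceRegular.

(* Main.v *)
Require Import Defs.
From mathcomp Require Import all_boot all_order all_algebra.
From mathcomp Require Import ring lra.
From mathcomp Require Import all_classical all_reals all_analysis.

Import Order.TTheory GRing.Theory Num.Theory.
Import numFieldNormedType.Exports.
Local Open Scope classical_set_scope.
Local Open Scope ring_scope.

(** Left regular multiplication by a Blaschke function [B_c] is an isometry of
    [H^2], and [<f, (1 - q c^bar)^-*>] is, up to notation, the value [f(c)].  Let
    [f] be orthogonal to every [Phi_n].  Orthogonality to [Phi_1] gives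
    [f(a_1) = 0], so [f = B_{a_1} * F_1]; cancelling the isometry, orthogonality
    to [Phi_2] gives [F_1(a_2) = 0], so [F_1 = B_{a_2} * F_2], and so on.  This
    yields functions [F_n] with [F_n = B_{a_{n+1}} * F_{n+1}] and norms all
    bounded by that of [f].  Suppose that the coefficients of index below [m]
    of all the [F_n] vanish.  Then the coefficient of index [m] of [F_n] is
    [B_{a_{n+1}}(0) = - a_{n+1}] times that of [F_{n+1}], hence is bounded by
    [|a_{n+1}| ... |a_N|] times a constant, which tends to zero because
    [sum (1 - |a_n|)] diverges.  Inducting on [m] for all [n] at once makes every
    coefficient vanish, including when some of the [a_n] are zero.

    Everything happens on coefficient sequences, where the relation
    [f = B_c * f'] becomes local: it says that [f = (q - c) * g] and
    [f' = (1 - q c^bar) * g] for some [g] ([blaschke_quotient]).  In these terms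
    the isometry is a telescoping identity for partial inner products with
    remainder [(1 - |c|^2) conj(h_n) g_n] ([telescope_identity],
    [quotient_inner], [quotient_l2]), so no double series are needed, and
    division by [B_c] at a zero [c] is [quotient_div].  [coefs_MT] identifies
    the coefficients of the Malmquist-Takenaka functions, and [quotient_vanish]
    is the final induction. *)

(** * Quaternions *)

Section Quat.
Context {R : realType}.
Implicit Types (p q c : quat R) (r s : R).

Lemma sqr_normqE q : `|q| ^+ 2 = qre q ^+ 2 + qi q ^+ 2 + qj q ^+ 2 + qk q ^+ 2.
Proof. by rewrite -qre_mul_conjq sqr_sqrtr ?qre_mul_conjq_ge0. Qed.

Lemma normqM p q : `|p * q| = `|p| * `|q|.
Proof.
apply/eqP; rewrite -(@eqrXn2 _ 2) ?mulr_ge0// exprMn !sqr_normqE.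
by apply/eqP => /=; ring.
Qed.

Lemma normqX q n : `|q ^+ n| = `|q| ^+ n.
Proof.
elim: n => [|n IH]; last by rewrite !exprS normqM IH.
apply/eqP; rewrite -(@eqrXn2 _ 2)// sqr_normqE /=.
by apply/eqP; ring.
Qed.

Lemma norm_conjq q : `|conjq q| = `|q|.
Proof.
apply/eqP; rewrite -(@eqrXn2 _ 2)// !sqr_normqE /=.
by apply/eqP; ring.
Qed.

Lemma conjqM p q : conjq (p * q) = conjq q * conjq p.
Proof. by case: p q => [? ? ? ?] [? ? ? ?]; congr Quat => /=; ring. Qed.

Lemma conjqX q n : conjq (q ^+ n) = conjq q ^+ n.
Proof.
elim: n => [|n IH]; last by rewrite exprS exprSr conjqM IH.
by congr Quat => /=; rewrite oppr0.
Qed.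

Lemma conjqZ r q : conjq (r *: q) = r *: conjq q.
Proof. by case: q => [? ? ? ?]; congr Quat => /=; ring. Qed.

Lemma conjqK : involutive (@conjq R).
Proof. by case=> [? ? ? ?]; congr Quat => /=; rewrite opprK. Qed.

Lemma conjq_comm c : c * conjq c = conjq c * c.
Proof. by rewrite mul_conjqE conjq_mulE. Qed.

(** The cross terms [conj(h') c g] and [conj(h) c^bar g'] occur in both
    products and cancel: this is what makes [B_c] an isometry. *)
Lemma telescope_identity c (g g' h h' : quat R) :
  conjq (h' - c * h) * (g' - c * g)
  - conjq (h - conjq c * h') * (g - conjq c * g')
  = (1 - `|c| ^+ 2) *: (conjq h' * g' - conjq h * g).
Proof.
rewrite sqr_normqE.
by case: c g g' h h' => [? ? ? ?] [? ? ? ?] [? ? ? ?] [? ? ? ?] [? ? ? ?];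
  congr Quat => /=; ring.
Qed.

Lemma ler_component r q : r ^+ 2 <= `|q| ^+ 2 -> `|r| <= `|q|.
Proof. by move=> H; rewrite -(@ler_pXn2r _ 2) ?nnegrE// real_normK ?num_real. Qed.

Lemma norm_qre q : `|qre q| <= `|q|.
Proof. by apply: ler_component; rewrite sqr_normqE -!addrA lerDl !addr_ge0 ?sqr_ge0. Qed.
Lemma norm_qi q : `|qi q| <= `|q|.
Proof.
apply: ler_component; rewrite sqr_normqE.
by have := (sqr_ge0 (qre q), sqr_ge0 (qj q), sqr_ge0 (qk q)) => -[[]]; lra.
Qed.
Lemma norm_qj q : `|qj q| <= `|q|.
Proof.
apply: ler_component; rewrite sqr_normqE.
by have := (sqr_ge0 (qre q), sqr_ge0 (qi q), sqr_ge0 (qk q)) => -[[]]; lra.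
Qed.
Lemma norm_qk q : `|qk q| <= `|q|.
Proof.
apply: ler_component; rewrite sqr_normqE.
by have := (sqr_ge0 (qre q), sqr_ge0 (qi q), sqr_ge0 (qj q)) => -[[]]; lra.
Qed.

Definition basis_i : quat R := Quat 0 1 0 0.
Definition basis_j : quat R := Quat 0 0 1 0.
Definition basis_k : quat R := Quat 0 0 0 1.

Lemma quat_basis q :
  q = qre q *: 1 + qi q *: basis_i + qj q *: basis_j + qk q *: basis_k.
Proof. by case: q => [? ? ? ?]; congr Quat => /=; ring. Qed.

(** Completeness of the quaternions is only needed for geometrically dominated
    series, and follows from that of the reals component by component. *)
Lemma quat_geometric_cvg (u : nat -> quat R) (C r : R) : 0 <= r < 1 ->
  (forall n, `|u n| <= C * r ^+ n) -> cvgn (series u).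
Proof.
move=> /andP[r0 r1] uC.
have comp (w : R^nat) : (forall n, `|w n| <= `|u n|) -> cvgn (series w).
  move=> wu; apply: normed_cvg; apply: (@series_le_cvg _ _ (geometric C r)).
  - by move=> n /=.
  - by move=> n; apply: le_trans (uC n); exact: le_trans (normr_ge0 _).
  - by move=> n /=; apply: le_trans (wu n) (uC n).
  by apply: is_cvg_geometric_series; rewrite ger0_norm.
have c0 := comp (@qre R \o u) (fun n => norm_qre (u n)).
have c1 := comp (@qi R \o u) (fun n => norm_qi (u n)).
have c2 := comp (@qj R \o u) (fun n => norm_qj (u n)).
have c3 := comp (@qk R \o u) (fun n => norm_qk (u n)).
have -> : series u = fun n => series (@qre R \o u) n *: (1 : quat R)
  + series (@qi R \o u) n *: basis_i + series (@qj R \o u) n *: basis_j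
  + series (@qk R \o u) n *: basis_k.
  apply/funext => n; rewrite /series /= !scaler_suml -!big_split /=.
  by apply: eq_bigr => i _; exact: quat_basis.
by apply: is_cvgD; [apply: is_cvgD; [apply: is_cvgD|]|]; apply: is_cvgZr_tmp.
Qed.

End Quat.

(** * Limits of quaternion sequences *)

Section Limits.
Context {R : realType}.
Implicit Types (u v : nat -> quat R) (p q : quat R).

Lemma null_seqP u : u @ \oo --> (0 : quat R) <->
  forall e : R, 0 < e -> exists N, forall n, (N <= n)%N -> `|u n| <= e.
Proof.
split=> [/cvgr0Pnorm_le u0 e e0|H].
  by have [N _ HN] := u0 e e0; exists N => n; exact: HN.
by apply/cvgr0Pnorm_le => e /H[N HN]; exists N.
Qed.

Lemma null_seq_bounded u : u @ \oo --> (0 : quat R) -> exists C, forall n, `|u n| <= C.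
Proof.
move=> /null_seqP/(_ _ ltr01)[N HN]; exists (1 + \sum_(k < N) `|u k|) => n.
have [Nn|nN] := leqP N n; first by rewrite (le_trans (HN n Nn))// lerDl sumr_ge0.
by rewrite (bigD1 (Ordinal nN))//= addrCA lerDl addr_ge0// sumr_ge0.
Qed.

Lemma null_seq_le u v C : v @ \oo --> (0 : quat R) ->
  (forall n, `|u n| <= C * `|v n|) -> u @ \oo --> (0 : quat R).
Proof.
move=> v0 uv; apply: norm_cvg0.
apply: (@squeeze_cvgr _ _ _ _ (cst 0) (fun n => C * `|v n|)).
- by near=> n; rewrite normr_ge0 uv.
- exact: cvg_cst.
- rewrite -[X in _ --> X](mulr0 C); apply: cvgMr; rewrite -(normr0 (quat R)).
  exact: cvg_norm.
Unshelve. all: by end_near. Qed.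

Lemma null_seqM u v C : v @ \oo --> (0 : quat R) -> (forall n, `|u n| <= C) ->
  (fun n => u n * v n) @ \oo --> (0 : quat R).
Proof.
by move=> v0 uC; apply: (null_seq_le _ _ C v0) => n; rewrite normqM ler_wpM2r.
Qed.

Lemma null_cvgP u q : (fun n => u n - q) @ \oo --> (0 : quat R) <-> u @ \oo --> q.
Proof.
split=> [u0|uq].
  rewrite -[q]add0r (_ : u = (fun n => u n - q) \+ cst q).
    by apply: cvgD => //; exact: cvg_cst.
  by apply/funext => n /=; rewrite subrK.
by rewrite -(subrr q); apply: cvgB => //; exact: cvg_cst.
Qed.

Lemma cvg_mulql u p q : u @ \oo --> q -> (fun n => p * u n) @ \oo --> p * q.
Proof.
move=> /null_cvgP u0; apply/null_cvgP.
apply: (null_seq_le _ _ `|p| u0) => n.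
by rewrite -mulrBr normqM.
Qed.

Lemma lim_norm_le u q B : u @ \oo --> q -> (forall n, `|u n| <= B) -> `|q| <= B.
Proof.
move=> uq uB; have nq : (fun n => `|u n|) @ \oo --> `|q| by exact: cvg_norm.
rewrite -(cvg_lim (@Rhausdorff R) nq).
by apply: limr_le; [apply/cvg_ex; exists `|q| | near=> n; exact: uB].
Unshelve. all: by end_near. Qed.

Lemma geometric_sum_le (C r : R) n : 0 <= r < 1 -> 0 <= C ->
  \sum_(k < n) C * r ^+ k <= C / (1 - r).
Proof.
move=> /andP[r0 r1] C0; rewrite ler_pdivlMr ?subr_gt0//.
have -> : (\sum_(k < n) C * r ^+ k) * (1 - r) = C * (1 - r ^+ n).
  rewrite -mulr_sumr -mulrA; congr (_ * _).
  by rewrite -[1 in RHS](expr1n _ n) subrXX mulrC; congr (_ * _);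
    apply: eq_bigr => i _; rewrite expr1n mul1r.
by rewrite ler_piMr// gerBl exprn_ge0.
Qed.

Lemma geometric_series_norm_le u (C r : R) n : 0 <= r < 1 ->
  (forall k, `|u k| <= C * r ^+ k) -> `|series u n| <= C / (1 - r).
Proof.
move=> r01 uC; have C0 : 0 <= C.
  by have := le_trans (normr_ge0 _) (uC 0%N); rewrite expr0 mulr1.
apply: le_trans (geometric_sum_le C r n r01 C0).
rewrite /series /= big_mkord; apply: le_trans (ler_norm_sum _ _ _) _.
by apply: ler_sum => i _.
Qed.

(** Iterating the inequality from a rank [N] on gives
    [|h_{N+k}| <= r^k |h_N| + sup_{n >= N} |d_n| / (1 - r)], and both terms can be
    made small. *)
Lemma contraction_null (h d : nat -> quat R) (r : R) : 0 <= r < 1 ->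
  (forall n, `|h n.+1| <= r * `|h n| + `|d n.+1|) ->
  d @ \oo --> (0 : quat R) -> h @ \oo --> (0 : quat R).
Proof.
move=> /andP[r0 r1] hd /null_seqP d0; apply/null_seqP => e e0.
have [|N HN] := d0 (e / 2 * (1 - r)); first by rewrite mulr_gt0 ?divr_gt0 ?subr_gt0.
have tail k : `|h (N + k)%N| <= r ^+ k * `|h N| + e / 2.
  elim: k => [|k IH]; first by rewrite addn0 expr0 mul1r lerDl ltW ?divr_gt0.
  rewrite addnS (le_trans (hd _))//.
  have dN : `|d (N + k).+1| <= e / 2 * (1 - r) by rewrite HN// -addnS leq_addr.
  have := ler_wpM2l r0 IH; rewrite exprS; move: dN.
  by rewrite mulrDr -[r * r ^+ k * _]mulrA; lra.
have rh0 : (fun k => r ^+ k *: h N) @ \oo --> (0 : quat R).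
  rewrite -(scale0r (h N)); apply: cvgZr_tmp; apply: cvg_expr.
  by rewrite ger0_norm.
have e20 : 0 < e / 2 by rewrite divr_gt0.
have [M HM] := (null_seqP _).1 rh0 _ e20.
exists (N + M)%N => n NMn.
have Nn : (N <= n)%N by apply: leq_trans NMn; exact: leq_addr.
have := tail (n - N)%N; rewrite subnKC// => /le_trans; apply.
have := HM (n - N)%N; rewrite leq_subRL// => /(_ NMn).
by rewrite normrZ ger0_norm ?exprn_ge0//; lra.
Qed.

End Limits.

(** * Formal series *)

Section FormalSeries.
Context {R : realType}.
Implicit Types (f g h u v x y z : nat -> quat R) (c p q : quat R).

Definition sconv x y n := \sum_(k < n.+1) x k * y (n - k)%N.

(** Coefficients of [q * g]; the formal variable commutes with all coefficients. *)
Definition delay g n := if n is m.+1 then g m else 0.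

Definition one_seq n : quat R := (n == 0%N)%:R.

(** Coefficients of the Szego kernel [(1 - q c^bar)^-*]. *)
Definition kernel_coefs c n : quat R := conjq c ^+ n.

(** Coefficients of [(q - c) * g]. *)
Definition blnum c g n := delay g n - c * g n.

(** Coefficients of [(1 - q c^bar) * g]. *)
Definition blden c g n := g n - conjq c * delay g n.

(** Since [c] and [c^bar] commute, the two factors of [B_c] may be exchanged;
    this form, [(q - c) * (1 - q c^bar)^-*], lets [blnum] act on the left. *)
Definition blaschke_coefs c := blnum c (kernel_coefs c).

(** A coefficient of a product only depends on truncations of the factors, so
    associativity is inherited from polynomials. *)
Lemma sconv_poly x y n N : (n < N)%N ->
  sconv x y n = (\poly_(i < N) x i * \poly_(i < N) y i)`_n.
Proof.
move=> nN; rewrite coefM; apply: eq_bigr => k _; rewrite !coef_poly.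
have -> : (k < N)%N by apply: leq_ltn_trans nN; rewrite -ltnS ltn_ord.
by have -> : (n - k < N)%N by apply: leq_ltn_trans nN; exact: leq_subr.
Qed.

Lemma sconvA x y z : sconv x (sconv y z) = sconv (sconv x y) z.
Proof.
apply/funext => n.
have coefc u v i : (\poly_(i < n.+1) sconv u v i)`_i =
   if (i < n.+1)%N then (\poly_(i < n.+1) u i * \poly_(i < n.+1) v i)`_i else 0.
  by rewrite coef_poly; case: ltnP => // /sconv_poly ->.
rewrite !(sconv_poly _ _ n n.+1)//.
transitivity ((\poly_(i < n.+1) x i * \poly_(i < n.+1) y i * \poly_(i < n.+1) z i)`_n).
  rewrite -mulrA !coefM; apply: eq_bigr => k _.
  by rewrite coefc ltnS leq_subr.
by rewrite !coefM; apply: eq_bigr => k _; rewrite coefc ltn_ord coefM.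
Qed.

Lemma sconv1l x : sconv one_seq x = x.
Proof.
apply/funext => n; rewrite /sconv big_ord_recl /one_seq /= mul1r subn0 big1 ?addr0//.
by move=> i _; rewrite mul0r.
Qed.

Lemma sconv1r x : sconv x one_seq = x.
Proof.
apply/funext => n; rewrite /sconv big_ord_recr /one_seq /= subnn mulr1 big1 ?add0r//.
by move=> i _; rewrite subn_eq0 leqNgt ltn_ord mulr0.
Qed.

Lemma delay_sconv x y : delay (sconv x y) = sconv (delay x) y.
Proof.
apply/funext => -[|n]; rewrite /sconv big_ord_recl /= mul0r add0r ?big_ord0//.
Qed.

Lemma blnum_sconv c x y : blnum c (sconv x y) = sconv (blnum c x) y.
Proof.
apply/funext => n; rewrite /blnum delay_sconv /sconv mulr_sumr -sumrB.
by apply: eq_bigr => i _; rewrite mulrBl mulrA.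
Qed.

Lemma blden_sconv c x y : blden c (sconv x y) = sconv (blden c x) y.
Proof.
apply/funext => n; rewrite /blden delay_sconv /sconv mulr_sumr -sumrB.
by apply: eq_bigr => i _; rewrite mulrBl mulrA.
Qed.

Lemma blden_kernel_coefs c : blden c (kernel_coefs c) = one_seq.
Proof.
apply/funext => -[|n]; rewrite /blden /kernel_coefs /one_seq /=.
  by rewrite mulr0 subr0.
by rewrite exprS subrr.
Qed.

(** Agreement of the two orders of the factors of [B_c]. *)
Lemma sconv_kernel_blnum c : sconv (kernel_coefs c) (blnum c one_seq) = blaschke_coefs c.
Proof.
apply/funext => -[|n].
  by rewrite /sconv big_ord1 /blaschke_coefs /blnum /kernel_coefs /one_seq /= !sub0r mul1r.
rewrite /sconv 2!big_ord_recr /= subSS subnn subSn// subnn big1 => [|i _].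
  rewrite /blaschke_coefs /blnum /kernel_coefs /one_seq /=.
  rewrite mulr0 !subr0 mulr1 add0r sub0r mulr1 mulrN.
  by congr (_ - _); apply/esym; apply: commrX; exact: conjq_comm.
have -> : (n.+1 - i)%N = (n - i.+1).+2 by rewrite subnSK// subSn// ltnW.
by rewrite /blnum /one_seq /= mulr0 subrr mulr0.
Qed.

End FormalSeries.

(** * Blaschke factors on coefficient sequences *)

Section Step.
Context {R : realType}.
Implicit Types (f g h u v x y z : nat -> quat R) (c p q : quat R).

Definition partial_inner y f := series (fun k => conjq (y k) * f k).

(** Encodes [f = B_c * f'] through [g = (1 - q c^bar)^-* * f'].  Both sequences
    are then local expressions in [g], and the condition on [g] makes the
    boundary terms of the telescoping sums disappear in the limit. *)
Definition blaschke_quotient c f f' := exists g,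
  [/\ g @ \oo --> (0 : quat R), f = blnum c g & f' = blden c g].

Lemma null_delay g : g @ \oo --> (0 : quat R) -> delay g @ \oo --> (0 : quat R).
Proof. by move=> g0; rewrite -cvg_shiftS; exact: g0. Qed.

Lemma null_blnum c g : g @ \oo --> (0 : quat R) -> blnum c g @ \oo --> (0 : quat R).
Proof.
move=> g0; rewrite -(subr0 (0 : quat R)); apply: cvgB; first exact: null_delay.
by rewrite -(mulr0 c); exact: cvg_mulql.
Qed.

Lemma null_blden c g : g @ \oo --> (0 : quat R) -> blden c g @ \oo --> (0 : quat R).
Proof.
move=> g0; rewrite -(subr0 (0 : quat R)); apply: cvgB => //.
by rewrite -(mulr0 (conjq c)); apply: cvg_mulql; exact: null_delay.
Qed.

(** [B_c] preserves inner products: by [telescope_identity] the partial sums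
    up to [n] differ by [(1 - |c|^2) conj(h_n) g_n]. Neither series has to be
    known to converge. *)
Lemma quotient_inner c f f' y y' :
  blaschke_quotient c f f' -> blaschke_quotient c y y' ->
  (fun n => partial_inner y f n - partial_inner y' f' n) @ \oo --> (0 : quat R).
Proof.
move=> [g [g0 -> ->]] [h [h0 -> ->]]; rewrite -cvg_shiftS.
have -> : (fun n => partial_inner (blnum c h) (blnum c g) n.+1
    - partial_inner (blden c h) (blden c g) n.+1)
  = (fun n => - (1 - `|c| ^+ 2) *: (conjq (h n) * g n)).
  apply/funext => n; rewrite /partial_inner /series /= -sumrB.
  under eq_bigr do rewrite telescope_identity.
  rewrite -scaler_sumr scaleNr -scalerN; congr (_ *: _).
  elim: n => [|n IH]; last by rewrite big_nat_recr//= IH addKr.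
  by rewrite big_nat1 /= mulr0 sub0r.
have [C hC] := null_seq_bounded _ h0.
rewrite -(scaler0 _ (- (1 - `|c| ^+ 2))); apply: cvgZl_tmp.
by apply: (null_seqM _ _ C g0) => n; rewrite norm_conjq.
Qed.

Lemma l2_null f (M : R) : (forall n, \sum_(k < n) `|f k| ^+ 2 <= M) ->
  f @ \oo --> (0 : quat R).
Proof.
move=> fM; apply/null_seqP => e e0.
have cv : cvgn (series (fun n => `|f n| ^+ 2)).
  apply: nondecreasing_is_cvgn.
    by apply/nondecreasing_series => n  _ _; rewrite exprn_ge0.
  by exists M => _ [n _ <-]; rewrite /series /= big_mkord.
have /cvgr0Pnorm_le/(_ (e ^+ 2)) := cvg_series_cvg_0 cv.
rewrite exprn_gt0// => /(_ isT)[N _ HN]; exists N => n /HN /=.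
by rewrite ger0_norm ?exprn_ge0// ler_pXn2r// ?nnegrE// ltW.
Qed.

(** The partial sums for [f'] exceed those for [f] by [(1 - |c|^2) |g_n|^2],
    so the bound holds only in the limit; as the partial sums for [f'] increase,
    it then holds for all of them. *)
Lemma quotient_l2 c f f' (M : R) : `|c| < 1 -> blaschke_quotient c f f' ->
  (forall n, \sum_(k < n) `|f k| ^+ 2 <= M) ->
  forall n, \sum_(k < n) `|f' k| ^+ 2 <= M.
Proof.
move=> c1 [g [/null_seqP g0 fE f'E]] fM n.
have tele N : \sum_(k < N.+1) `|f' k| ^+ 2
    = \sum_(k < N.+1) `|f k| ^+ 2 + (1 - `|c| ^+ 2) * `|g N| ^+ 2.
  rewrite fE f'E /blnum /blden; elim: N => [|N IH].
    rewrite !big_ord1 /= mulr0 subr0 sub0r normrN normqM; ring.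
  rewrite big_ord_recr/= IH [in RHS]big_ord_recr/= -!addrA; congr (_ + _).
  rewrite !sqr_normqE; move: (g N) (g N.+1) => [? ? ? ?] [? ? ? ?].
  by case: (c) => [? ? ? ?] /=; ring.
apply/ler_addgt0Pr => e e0.
have [|N HN] := g0 (Num.min 1 e); first by rewrite lt_min ltr01.
pose K := maxn n N.
apply: (@le_trans _ _ (\sum_(k < K.+1) `|f' k| ^+ 2)).
  rewrite (@big_ord_widen _ _ _ n K.+1 (fun k => `|f' k| ^+ 2)); last first.
    by rewrite ltnW// ltnS leq_maxl.
  rewrite [leRHS](bigID (fun i : 'I_K.+1 => (i < n)%N))/= lerDl sumr_ge0//.
rewrite tele; apply: lerD => //.
have := HN K (leq_maxr _ _); rewrite le_min => /andP[g1 ge].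
apply: le_trans (_ : `|g K| ^+ 2 <= e).
  by rewrite ler_piMl ?exprn_ge0// gerBl exprn_ge0.
by rewrite expr2 (le_trans _ ge)// ler_piMr.
Qed.

(** The value at [c] of the regular function with coefficients [f]. *)
Definition evalq c f := limn (series (fun j => c ^+ j * f j)).

Lemma evalq_term_le c f C k : (forall n, `|f n| <= C) ->
  `|c ^+ k * f k| <= C * `|c| ^+ k.
Proof. by move=> fC; rewrite normqM normqX mulrC ler_wpM2r// exprn_ge0. Qed.

Lemma evalq_cvg c f C : `|c| < 1 -> (forall n, `|f n| <= C) ->
  series (fun j => c ^+ j * f j) @ \oo --> evalq c f.
Proof.
move=> c1 fC; rewrite /evalq.
apply: (quat_geometric_cvg _ C `|c|); first by rewrite normr_ge0.
by move=> n; exact: evalq_term_le.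
Qed.

Lemma evalq_le c f C : `|c| < 1 -> (forall n, `|f n| <= C) ->
  `|evalq c f| <= C / (1 - `|c|).
Proof.
move=> c1 fC; apply: lim_norm_le (evalq_cvg _ _ _ c1 fC) _ => n.
apply: geometric_series_norm_le; first by rewrite normr_ge0.
by move=> k; exact: evalq_term_le.
Qed.

(** Horner's rule for a power series. *)
Lemma evalq_recl c f C : `|c| < 1 -> (forall n, `|f n| <= C) ->
  evalq c f = f 0%N + c * evalq c (f \o succn).
Proof.
move=> c1 fC; apply: (cvg_unique (@norm_hausdorff _ (quat R)) (evalq_cvg _ _ _ c1 fC)).
rewrite /= -cvg_shiftS.
have -> : (fun n => series (fun j => c ^+ j * f j) n.+1)
    = (fun n => f 0%N + c * series (fun j => c ^+ j * (f \o succn) j) n).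
  apply/funext => n; rewrite /series /= !big_mkord big_ord_recl expr0 mul1r.
  by rewrite mulr_sumr; congr (_ + _); apply: eq_bigr => i _; rewrite exprS mulrA.
apply: cvgD; first exact: cvg_cst.
by apply: cvg_mulql; apply: (evalq_cvg _ _ C) => // n; exact: fC.
Qed.

(** A zero at [c] allows division by [q - c].  The quotient is built from its
    tails [g_n = sum_j c^j f_{n+1+j}] rather than by forward recursion: this
    makes sense for [c = 0] too and shows that [g] tends to zero. *)
Lemma quotient_div c f : `|c| < 1 -> f @ \oo --> (0 : quat R) -> evalq c f = 0 ->
  exists f', blaschke_quotient c f f'.
Proof.
move=> c1 f0 fc0; have [C fC] := null_seq_bounded _ f0.
pose g n := evalq c (fun j => f (n + j).+1).
exists (blden c g), g; split=> //.
  apply/null_seqP => e e0; have c10 : 0 < 1 - `|c| by rewrite subr_gt0.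
  have [|N HN] := (null_seqP f).1 f0 (e * (1 - `|c|)); first by rewrite mulr_gt0.
  exists N => n Nn; rewrite -[leRHS](mulfK (lt0r_neq0 c10)).
  apply: evalq_le => // k; apply: HN.
  by rewrite (leq_trans Nn)// ltnW// ltnS leq_addr.
apply/funext => -[|n]; rewrite /blnum /=.
  move: fc0; rewrite (evalq_recl _ _ C)// => /eqP; rewrite addr_eq0 => /eqP ->.
  by rewrite sub0r /g.
rewrite /g (evalq_recl _ _ C)//= addn0.
rewrite (_ : _ \o _ = (fun j => f (n.+1 + j).+1)) ?addrK//.
by apply/funext => j /=; rewrite addnS.
Qed.

(** The first nonzero coefficient gets multiplied by [B_c(0) = - c]. *)
Lemma quotient_lead c f f' m : blaschke_quotient c f f' ->
  (forall j, (j < m)%N -> f' j = 0) ->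
  f m = - c * f' m.
Proof.
move=> [g [_ -> ->]] f'0.
have g0 j : (j < m)%N -> g j = 0.
  elim: j => [|j IH] jm.
    by have := f'0 _ jm; rewrite /blden /= mulr0 subr0.
  by have := f'0 _ jm; rewrite /blden /= IH ?mulr0 ?subr0// ltnW.
have s0 : delay g m = 0 by case: m g0 {f'0} => //= n; apply.
by rewrite /blnum /blden s0 mulr0 subr0 sub0r mulNr.
Qed.

(** Here [g = (1 - q c^bar)^-* * y] satisfies [g_{n+1} = y_{n+1} + c^bar g_n],
    a perturbed contraction, and so tends to zero with [y]. *)
Lemma quotient_blaschke c y : `|c| < 1 -> y @ \oo --> (0 : quat R) ->
  blaschke_quotient c (sconv (blaschke_coefs c) y) y.
Proof.
move=> c1 y0; exists (sconv (kernel_coefs c) y).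
have dE : blden c (sconv (kernel_coefs c) y) = y.
  by rewrite blden_sconv blden_kernel_coefs sconv1l.
split; [|by rewrite blnum_sconv|by rewrite dE].
apply: (contraction_null _ y `|c|) => [|n|//]; first by rewrite normr_ge0.
move: (congr1 (@^~ n.+1) dE); rewrite /= {1}/blden /= => /eqP.
rewrite subr_eq => /eqP ->; rewrite addrC (le_trans (ler_normD _ _))//.
by rewrite normqM norm_conjq.
Qed.

Lemma null_blaschke_sconv c y : `|c| < 1 -> y @ \oo --> (0 : quat R) ->
  sconv (blaschke_coefs c) y @ \oo --> (0 : quat R).
Proof. by move=> c1 /(quotient_blaschke _ _ c1)[g [g0 -> _]]; exact: null_blnum. Qed.

Lemma null_one : one_seq @ \oo --> (0 : quat R).
Proof. by apply/null_seqP => e e0; exists 1%N => -[|n]// _; rewrite normr0 ltW. Qed.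

Lemma null_kernel_coefs c : `|c| < 1 -> kernel_coefs c @ \oo --> (0 : quat R).
Proof.
move=> c1; apply: (contraction_null _ one_seq `|c|) null_one => [|n].
  by rewrite normr_ge0.
by rewrite /kernel_coefs exprS normqM norm_conjq lerDl.
Qed.

(** Right-nested, so that the outermost factor can be cancelled first. *)
Definition blprod (s : seq (quat R)) y := foldr (fun c => sconv (blaschke_coefs c)) y s.

Lemma null_blprod s y : all (fun c => `|c| < 1) s ->
  y @ \oo --> (0 : quat R) -> blprod s y @ \oo --> (0 : quat R).
Proof. by elim: s => //= c s IH /andP[c1 /IH +] y0 => /(_ y0); exact: null_blaschke_sconv. Qed.

Lemma blprod_sconv s y : sconv (blprod s one_seq) y = blprod s y.
Proof. by elim: s => [|c s IH] /=; rewrite ?sconv1l// -sconvA IH. Qed.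

(** Cancelling [B_{a 0} * ... * B_{a (n-1)}] from both arguments of the inner
    product, one isometry at a time. *)
Lemma partial_inner_blprod (a : nat -> quat R) (F : nat -> nat -> quat R) n y :
  (forall i, `|a i| < 1) ->
  (forall i, (i < n)%N -> blaschke_quotient (a i) (F i) (F i.+1)) ->
  y @ \oo --> (0 : quat R) ->
  (fun k => partial_inner (blprod (mkseq a n) y) (F 0%N) k
    - partial_inner y (F n) k) @ \oo --> (0 : quat R).
Proof.
move=> a1; elim: n y => [|n IH] y aF y0.
  by under eq_fun do rewrite subrr; exact: cvg_cst.
rewrite mkseqS /blprod foldr_rcons -/(blprod _ _).
have H1 := IH (sconv (blaschke_coefs (a n)) y) (fun i im => aF i (leqW im))
  (null_blaschke_sconv _ _ (a1 n) y0).
have H2 := quotient_inner _ _ _ _ _ (aF n (ltnSn n)) (quotient_blaschke _ _ (a1 n) y0).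
pose z := partial_inner (sconv (blaschke_coefs (a n)) y) (F n).
have -> : (fun k =>
    partial_inner (blprod (mkseq a n) (sconv (blaschke_coefs (a n)) y)) (F 0%N) k
    - partial_inner y (F n.+1) k) = (fun k =>
  (partial_inner (blprod (mkseq a n) (sconv (blaschke_coefs (a n)) y)) (F 0%N) k - z k)
  + (z k - partial_inner y (F n.+1) k)) by apply/funext => k; rewrite addrA subrK.
by rewrite -(addr0 (0 : quat R)); exact: cvgD H1 H2.
Qed.

(** Strong induction on the index [m] of the coefficient, for all [n] at once.
    The decay of [prod |a_k|] is used in the elementary form
    [prod |a_k| * (1 + sum (1 - |a_k|)) <= 1], a consequence of
    [t (1 + S + (1 - t)) <= 1 + S] for [0 <= t <= 1] and [0 <= S]. *)
Lemma quotient_vanish (a : nat -> quat R) (F : nat -> nat -> quat R) (M : R) :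
  (forall n, `|a n| < 1) ->
  (forall n B, exists N, B <= \sum_(k < N) (1 - `|a (n + k)%N|)) ->
  (forall n, blaschke_quotient (a n) (F n) (F n.+1)) ->
  (forall n m, `|F n m| <= M) ->
  forall m n, F n m = 0.
Proof.
move=> a1 div aF FM m; elim/ltn_ind: m => m IH n.
have lead i : `|F i m| = `|a i| * `|F i.+1 m|.
  rewrite (quotient_lead _ _ _ m (aF i)) ?normqM ?normrN//.
  by move=> j jm; exact: IH.
have bound N i : `|F i m| * (1 + \sum_(k < N) (1 - `|a (i + k)%N|)) <= M.
  elim: N i => [|N IHN] i; first by rewrite big_ord0 addr0 mulr1.
  apply: le_trans (IHN i.+1); rewrite lead big_ord_recl addn0.
  under eq_bigr do rewrite /= /bump leq0n add1n addnS -addSn.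
  set S := \sum_(_ < _) _.
  have S0 : 0 <= S by apply: sumr_ge0 => k _; rewrite subr_ge0 ltW.
  rewrite mulrAC [leRHS]mulrC; apply: ler_wpM2r => //.
  have := a1 i; have := normr_ge0 (a i); move: `|a i| => t t0 t1; nra.
apply/eqP; rewrite -normr_eq0 eq_le normr_ge0 andbT leNgt; apply/negP => F0.
have [N HN] := div n (M / `|F n m|).
have := bound N n; rewrite leNgt => /negP; apply.
have := ler_wpM2r (ltW F0) HN; rewrite divfK ?lt0r_neq0//.
by move: F0; lra.
Qed.

End Step.

(** * Power series expansions *)

Section Expansions.
Context {R : realType}.
Implicit Types (x y d : nat -> quat R) (f g : quat R -> quat R) (c q : quat R).

Lemma normq1 : `|1 : quat R| = 1.
Proof. by have := normqX (0 : quat R) 0; rewrite !expr0. Qed.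

Lemma cvg_mulqr x q c : x @ \oo --> q -> (fun n => x n * c) @ \oo --> q * c.
Proof.
move=> /null_cvgP x0; apply/null_cvgP.
by apply: (null_seq_le _ _ `|c| x0) => n; rewrite -mulrBl normqM mulrC.
Qed.

(** Letting [c] tend to [0] in [d_0 = - c * (d_1 + c d_2 + ...)]; the last
    factor stays bounded. *)
Lemma evalq_eq0_head d (C : R) : (forall n, `|d n| <= C) ->
  (forall c, c != 0 -> `|c| < 1 -> evalq c d = 0) -> d 0%N = 0.
Proof.
move=> dC ev0; have C0 : 0 <= C := le_trans (normr_ge0 _) (dC 0%N).
apply/eqP; rewrite -normr_le0; apply/ler_addgt0Pr => e e0; rewrite add0r.
have C10 : 0 < 2 * (C + 1) by lra.
pose t := Num.min (2^-1) (e / (2 * (C + 1))).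
have t0 : 0 < t by rewrite lt_min invr_gt0 ltr0n divr_gt0.
have t12 : t <= 2^-1 by rewrite ge_min lexx.
have te : t * (2 * (C + 1)) <= e by rewrite -ler_pdivlMr// ge_min lexx orbT.
have tnorm : `|t%:A : quat R| = t by rewrite normrZ normq1 mulr1 gtr0_norm.
have t1 : `|t%:A : quat R| < 1 by rewrite tnorm; lra.
have := ev0 t%:A; rewrite -normr_eq0 tnorm gt_eqF// => /(_ isT).
rewrite -[X in X < 1]tnorm => /(_ t1); rewrite (evalq_recl _ _ C)// => /eqP; rewrite addr_eq0 => /eqP ->.
rewrite normrN normqM tnorm.
have := evalq_le _ (d \o succn) C t1 (fun n => dC n.+1); rewrite tnorm.
move: `|evalq _ _| => E; rewrite ler_pdivlMr; last by lra.
move=> EC; apply: le_trans te; apply: ler_wpM2l; first exact: ltW.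
have [E0|E0] := leP E 0; first lra.
nra.
Qed.

(** Identity theorem at the origin: once [d_0 = 0], a factor [c] can be
    cancelled, which is why only [c != 0] is assumed. *)
Lemma evalq_eq0 d (C : R) m : (forall n, `|d n| <= C) ->
  (forall c, c != 0 -> `|c| < 1 -> evalq c d = 0) -> d m = 0.
Proof.
elim: m d => [|m IH] d dC ev0; first exact: evalq_eq0_head ev0.
apply: (IH (d \o succn)) => [n|c c0 c1]; first exact: dC.
have := ev0 c c0 c1; rewrite (evalq_recl _ _ C)// (evalq_eq0_head _ C)// add0r.
by move=> /(congr1 ( *%R c^-1)); rewrite mulr0 mulKr.
Qed.

(** The coefficients of a series converging on the ball need not be bounded;
    rescaling the variable by [1/2] makes them so. *)
Lemma has_expansion_uniq f x y : has_expansion f x -> has_expansion f y -> x = y.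
Proof.
move=> fx fy; apply/funext => m; apply/eqP; rewrite -subr_eq0; apply/eqP.
pose d n := x n - y n; rewrite -/(d m).
have dcvg q : `|q| < 1 -> series (fun n => q ^+ n * d n) @ \oo --> (0 : quat R).
  move=> q1; rewrite -(subrr (f q)).
  have -> : series (fun n => q ^+ n * d n) = (fun k =>
      series (fun n => q ^+ n * x n) k - series (fun n => q ^+ n * y n) k).
    by apply/funext => k; rewrite /series /= -sumrB; under eq_bigr do rewrite mulrBr.
  by apply: cvgB; [exact: fx|exact: fy].
have h1 : `|2^-1%:A : quat R| < 1.
  by rewrite normrZ normq1 mulr1 ger0_norm ?invr_ge0// invf_lt1// ltr1n.
have sc c n : (2^-1 *: c) ^+ n * d n = c ^+ n * (2^-1 ^+ n *: d n).
  by rewrite exprZn -scalerAl scalerAr.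
have cvh : cvgn (series (fun n => (2^-1%:A : quat R) ^+ n * d n)).
  by apply/cvg_ex; exists 0; exact: dcvg.
have [C dC] := null_seq_bounded _ (cvg_series_cvg_0 cvh).
have dm0 : 2^-1 ^+ m *: d m = 0.
  apply: (evalq_eq0 (fun n => 2^-1 ^+ n *: d n) C) => [n|c _ c1].
    by have := dC n; rewrite sc expr1n mul1r.
  apply: cvg_lim; first exact: norm_hausdorff.
  under eq_fun do rewrite -sc.
  apply: dcvg; rewrite normrZ ger0_norm ?invr_ge0//.
  by rewrite (le_lt_trans _ c1)// ler_piMl// invf_le1// ler1n.
by move/eqP: dm0; rewrite scaler_eq0 expf_eq0 invr_eq0 pnatr_eq0 andbF /= => /eqP.
Qed.

Lemma coefsE f x : has_expansion f x -> coefs f = x.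
Proof. by move=> fx; apply: xget_unique => // y fy; exact: has_expansion_uniq fy fx. Qed.

Lemma power_series_expansion x (C : R) : (forall n, `|x n| <= C) ->
  has_expansion (power_series x) x.
Proof. by move=> xC q q1; exact: (evalq_cvg _ _ C q1 xC). Qed.

Lemma power_seriesE f x q : has_expansion f x -> `|q| < 1 -> power_series x q = f q.
Proof. by move=> fx q1; apply: cvg_lim (fx q q1); exact: norm_hausdorff. Qed.

Lemma null_expansion x : x @ \oo --> (0 : quat R) -> has_expansion (power_series x) x.
Proof. by move=> /null_seq_bounded[C xC]; exact: power_series_expansion xC. Qed.

Lemma rmul_expansion f g x y : has_expansion f x -> has_expansion g y ->
  sconv x y @ \oo --> (0 : quat R) -> has_expansion (rmul f g) (sconv x y).
Proof.
move=> fx gy xy0; rewrite /rmul (coefsE _ _ fx) (coefsE _ _ gy).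
exact: null_expansion.
Qed.

Lemma finite_expansion f x N : (forall n, (N <= n)%N -> x n = 0) ->
  (forall q, `|q| < 1 -> f q = \sum_(k < N) q ^+ k * x k) -> has_expansion f x.
Proof.
move=> xN fE q q1; rewrite fE//; apply: cvg_near_cst; exists N => // n /= Nn.
rewrite /series /= big_mkord -(subnKC Nn) big_split_ord/= [X in _ + X]big1 ?addr0//.
by move=> i _; rewrite xN ?mulr0// leq_addr.
Qed.

Lemma expansion_sub c : has_expansion (fun q => q - c) (blnum c one_seq).
Proof.
apply: (finite_expansion _ _ 2) => [[|[|n]]//= _|q _].
  by rewrite /blnum /one_seq /= mulr0 subr0.
rewrite big_ord_recl big_ord1 /blnum /one_seq /=.
by rewrite expr0 expr1 mulr0 subr0 !mulr1 mul1r sub0r addrC.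
Qed.

Lemma expansion_1sub c : has_expansion (fun q => 1 - q * conjq c) (blden c one_seq).
Proof.
apply: (finite_expansion _ _ 2) => [[|[|n]]//= _|q _].
  by rewrite /blden /one_seq /= mulr0 subr0.
rewrite big_ord_recl big_ord1 /blden /one_seq /=.
by rewrite expr0 expr1 mulr0 subr0 !mulr1 sub0r mulrN.
Qed.

Lemma conj_blden c : (fun n => conjq (blden c one_seq n)) = blden (conjq c) one_seq.
Proof.
apply/funext => n; rewrite /blden /one_seq.
have conjB (p r : quat R) : conjq (p - r) = conjq p - conjq r.
  by case: p r => [? ? ? ?] [? ? ? ?]; congr Quat => /=; ring.
have conj_nat (k : nat) : conjq (k%:R : quat R) = k%:R.
  elim: k => [|k IH]; first by congr Quat => /=; rewrite oppr0.
  by rewrite -addn1 natrD -[in RHS]IH; congr Quat => /=; ring.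
rewrite conjB conjqM conjqK conj_nat; congr (_ - _).
case: n => [|n] /=; rewrite ?conj_nat; last first.
  by case: n => [|n]; rewrite ?mul1r ?mulr1 ?mul0r ?mulr0.
by rewrite mulr0 (conj_nat 0%N) mul0r.
Qed.

Lemma expansion_rconj c :
  has_expansion (rconj (fun q => 1 - q * conjq c)) (blden (conjq c) one_seq).
Proof.
rewrite /rconj (coefsE _ _ (expansion_1sub c)) conj_blden.
by apply: null_expansion; apply: null_blden; exact: null_one.
Qed.

Lemma rconj_1sub c q : `|q| < 1 -> rconj (fun q => 1 - q * conjq c) q = 1 - q * c.
Proof.
move=> q1; rewrite /rconj (coefsE _ _ (expansion_1sub c)) conj_blden.
by rewrite (power_seriesE _ _ _ (expansion_1sub (conjq c)))// conjqK.
Qed.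

Lemma rsym_1sub c q : `|q| < 1 -> rsym (fun q => 1 - q * conjq c) q =
  1 - q * (c + conjq c) + q ^+ 2 * (conjq c * c).
Proof.
move=> q1; rewrite /rsym /rmul (coefsE _ _ (expansion_1sub c)).
rewrite (coefsE _ _ (expansion_rconj c)).
have -> : (fun n =>
      \sum_(k < n.+1) blden c one_seq k * blden (conjq c) one_seq (n - k)%N)
    = blden c (blden (conjq c) one_seq).
  by rewrite -[in RHS](sconv1l (blden (conjq c) one_seq)) blden_sconv.
apply: (power_seriesE (fun q => 1 - q * (c + conjq c) + q ^+ 2 * (conjq c * c))) => //.
apply: (finite_expansion _ _ 3) => [[|[|[|n]]]//= _|r _].
  by rewrite /blden /one_seq /= !(mulr0, subr0).
rewrite 2!big_ord_recl big_ord1 /blden /one_seq /= /bump /=.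
rewrite !(mulr0, subr0, mulr1) conjqK expr0 expr1.
by rewrite !sub0r !mulrN opprK addrA -opprD mulrN.
Qed.

(** The kernel [G] satisfies [G = 1 + q G c^bar], although [q] and [c] do not
    commute: the power of [q] comes out on the left, that of [c^bar] on the
    right. *)
Lemma evalq_kernel_coefs c q : `|c| < 1 -> `|q| < 1 ->
  evalq q (kernel_coefs c) = 1 + q * evalq q (kernel_coefs c) * conjq c.
Proof.
move=> c1 q1; have [C gC] := null_seq_bounded _ (null_kernel_coefs _ c1).
rewrite {1}(evalq_recl _ _ C)//= [kernel_coefs c 0]expr0 -mulrA; congr (_ + _ * _).
apply: cvg_lim; first exact: norm_hausdorff.
have -> : series (fun j => q ^+ j * (kernel_coefs c \o succn) j)
    = (fun n => series (fun j => q ^+ j * kernel_coefs c j) n * conjq c).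
  apply/funext => n; rewrite /series /= mulr_suml.
  by apply: eq_bigr => i _; rewrite /kernel_coefs exprSr mulrA.
by apply: cvg_mulqr; exact: evalq_cvg gC.
Qed.

(** The symmetrization [P = 1 - 2 Re(c) q + |c|^2 q^2] has real coefficients, so
    [P G = (G - q G c^bar) - q (G - q G c^bar) c = 1 - q c].  It does not vanish
    at [q], for otherwise [|q c| = 1]. *)
Lemma rinv_1sub c q : `|c| < 1 -> `|q| < 1 ->
  rinv (fun q => 1 - q * conjq c) q = evalq q (kernel_coefs c).
Proof.
move=> c1 q1; rewrite /rinv rsym_1sub// rconj_1sub//.
set P := (1 - _ + _); set G := evalq _ _.
have GE := evalq_kernel_coefs _ _ c1 q1; rewrite -/G in GE.
have PG : P * G = 1 - q * c.
  have central (r : quat R) (t : R) : r * t%:A = t%:A * r.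
    by rewrite -scalerAr -scalerAl mulr1 mul1r.
  have trE : c + conjq c = (qre c *+ 2)%:A.
    by case: (c) => [? ? ? ?]; congr Quat => /=; ring.
  have h1 : (c + conjq c) * G = G * conjq c + G * c.
    by rewrite trE -central -trE mulrDr addrC.
  have h2 : conjq c * c * G = G * conjq c * c.
    by rewrite conjq_mulE -central -conjq_mulE mulrA.
  have -> : P * G = G - q * ((c + conjq c) * G) + q ^+ 2 * (conjq c * c * G).
    by rewrite /P mulrDl mulrBl mul1r !mulrA.
  transitivity (G - q * G * conjq c - q * (G - q * G * conjq c) * c); last first.
    by rewrite {1 3}GE !addrK mulr1.
  by rewrite h1 h2 mulrDr opprD mulrBr mulrBl opprB expr2 !mulrA !addrA [RHS]addrAC.
have P0 : P != 0.
  apply/eqP => P0; move: PG; rewrite P0 mul0r => /esym/eqP; rewrite subr_eq0 => /eqP qc.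
  have : `|q * c| < 1 by rewrite normqM mulr_ilt1.
  by rewrite -qc normq1 ltxx.
by rewrite -PG mulKr.
Qed.

Lemma expansion_kernel c : `|c| < 1 ->
  has_expansion (rinv (fun q => 1 - q * conjq c)) (kernel_coefs c).
Proof.
move=> c1 q q1; rewrite rinv_1sub//.
by have [C gC] := null_seq_bounded _ (null_kernel_coefs _ c1); exact: evalq_cvg gC.
Qed.

Lemma null_blaschke_coefs c : `|c| < 1 -> blaschke_coefs c @ \oo --> (0 : quat R).
Proof.
move=> c1; rewrite -(sconv1r (blaschke_coefs c)).
by apply: null_blaschke_sconv => //; exact: null_one.
Qed.

Lemma expansion_blaschke c : `|c| < 1 -> has_expansion (blaschke c) (blaschke_coefs c).
Proof.
move=> c1; rewrite -sconv_kernel_blnum; apply: rmul_expansion.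
- exact: expansion_kernel.
- exact: expansion_sub.
- by rewrite sconv_kernel_blnum; exact: null_blaschke_coefs.
Qed.

Lemma all_mkseq (a : nat -> quat R) n : (forall i, `|a i| < 1) ->
  all (fun c => `|c| < 1) (mkseq a n).
Proof. by move=> a1; apply/allP => _ /mapP[i _ ->]. Qed.

Lemma expansion_blaschke_prod (a : nat -> quat R) m : (forall i, `|a i| < 1) ->
  has_expansion (blaschke_prod a m) (blprod (mkseq a m.+1) one_seq).
Proof.
move=> a1; elim: m => [|m IH].
  by rewrite /= sconv1r; exact: expansion_blaschke.
rewrite mkseqS /blprod foldr_rcons sconv1r -/(blprod _ _) -blprod_sconv.
apply: rmul_expansion => //; first exact: expansion_blaschke.
rewrite blprod_sconv; apply: null_blprod; first exact: all_mkseq.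
exact: null_blaschke_coefs.
Qed.

Lemma coefs_MT (a : nat -> quat R) n : (forall i, `|a i| < 1) ->
  coefs (MT a n) = (fun k =>
    Num.sqrt (1 - `|a n| ^+ 2) *: blprod (mkseq a n) (kernel_coefs (a n)) k).
Proof.
move=> a1; apply: coefsE => q q1; rewrite /MT.
set s := Num.sqrt _.
have -> : series (fun k => q ^+ k * (s *: blprod (mkseq a n) (kernel_coefs (a n)) k))
   = (fun N =>
       s *: series (fun k => q ^+ k * blprod (mkseq a n) (kernel_coefs (a n)) k) N).
  apply/funext => N; rewrite /series /= scaler_sumr.
  by apply: eq_bigr => i _; rewrite scalerAr.
apply: cvgZl_tmp; case: n @s => [|n] s; first exact: expansion_kernel.
rewrite -blprod_sconv; apply: rmul_expansion q1.
- exact: expansion_blaschke_prod.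
- exact: expansion_kernel.
rewrite blprod_sconv; apply: null_blprod; first exact: all_mkseq.
exact: null_kernel_coefs.
Qed.

End Expansions.

(** * Completeness *)

Section Completeness.
Context {R : realType}.
Implicit Types (x y d : nat -> quat R) (f g : quat R -> quat R) (c q : quat R).

Lemma nneseries_tail_unbounded (t : nat -> R) : (forall n, 0 <= t n) ->
  (\sum_(n <oo) (t n)%:E)%E = +oo%E ->
  forall n B, exists N, B <= \sum_(k < N) t (n + k)%N.
Proof.
move=> t0 tdiv n B; apply: contrapT => /forallNP small.
have : (\sum_(k <oo) (t k)%:E <= (\sum_(k < n) t k + B)%:E)%E.
  apply: lime_le; first by apply: is_cvg_nneseries => k _ _; rewrite lee_fin.
  near=> N; rewrite sumEFin lee_fin big_mkord.
  have nN : (n <= N)%N by near: N; exact: nbhs_infty_ge.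
  rewrite -(subnKC nN) big_split_ord/= lerD2l.
  by have /negP := small (N - n)%N; rewrite -ltNge => /ltW.
by rewrite tdiv leye_eq.
Unshelve. all: by end_near. Qed.

Lemma H2_coefs f : H2 f ->
  exists2 M, has_expansion f (coefs f) & forall n, \sum_(k < n) `|coefs f k| ^+ 2 <= M.
Proof.
move=> [_ [x fx xfin]]; rewrite (coefsE _ _ fx).
exists (fine (\sum_(n <oo) (`|x n| ^+ 2)%:E)%E) => // n.
have pos k : (0 <= (`|x k| ^+ 2)%:E)%E by rewrite lee_fin exprn_ge0.
rewrite -lee_fin fineK; last first.
  by rewrite ge0_fin_numE//; apply: nneseries_ge0 => k _ _; exact: pos.
have := @nneseries_lim_ge _ (fun k => (`|x k| ^+ 2)%:E) xpredT 0 n (fun k _ _ => pos k).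
by rewrite sumEFin big_mkord.
Qed.

(** After cancelling the Blaschke factors, the inner product with the kernel
    at [a n] reproduces the value there.  The convergence of the series defining
    the inner product is part of what is shown. *)
Lemma H2_inner_MT (a : nat -> quat R) (F : nat -> nat -> quat R) f n (C : R) :
  (forall i, `|a i| < 1) -> (forall k, `|F n k| <= C) -> F 0%N = coefs f ->
  (forall i, (i < n)%N -> blaschke_quotient (a i) (F i) (F i.+1)) ->
  H2_inner f (MT a n) = Num.sqrt (1 - `|a n| ^+ 2) *: evalq (a n) (F n).
Proof.
move=> a1 FC F0 aF; rewrite /H2_inner coefs_MT//.
set s := Num.sqrt _; pose y := kernel_coefs (a n).
have -> : series (fun k => conjq (s *: blprod (mkseq a n) y k) * coefs f k)
    = (fun N => s *: partial_inner (blprod (mkseq a n) y) (F 0%N) N).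
  apply/funext => N; rewrite /partial_inner /series /= scaler_sumr F0.
  by apply: eq_bigr => i _; rewrite conjqZ scalerAl.
apply: cvg_lim; first exact: norm_hausdorff.
apply: cvgZl_tmp.
have H1 := partial_inner_blprod a F n y a1 aF (null_kernel_coefs _ (a1 n)).
have H2 : partial_inner y (F n) @ \oo --> evalq (a n) (F n).
  rewrite /partial_inner /y; under eq_fun do rewrite conjqX conjqK.
  exact: evalq_cvg FC.
rewrite -[X in _ --> X]add0r (_ : partial_inner _ _ = (fun k =>
  (partial_inner (blprod (mkseq a n) y) (F 0%N) k - partial_inner y (F n) k)
  + partial_inner y (F n) k)).
  exact: cvgD H1 H2.
by apply/funext => k; rewrite subrK.
Qed.

(** The quotients are chosen one after the other; once those before rank [n]
    exist, [H2_inner_MT] turns orthogonality to [MT a n] into a zero at [a n], and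
    [quotient_div] provides the next one. *)
Lemma MT_orthogonal_eq0 (a : nat -> quat R) f : (forall i, `|a i| < 1) ->
  (forall n B, exists N, B <= \sum_(k < N) (1 - `|a (n + k)%N|)) ->
  H2 f -> (forall n, H2_inner f (MT a n) = 0) -> forall m, coefs f m = 0.
Proof.
move=> a1 div /H2_coefs[M _ fM] orth.
pose next c x := xget (fun=> 0) [set x' | blaschke_quotient c x x'].
pose F := fix F n := if n is m.+1 then next (a m) (F m) else coefs f.
have l2 n : (forall i, (i < n)%N -> blaschke_quotient (a i) (F i) (F i.+1)) ->
    forall N, \sum_(k < N) `|F n k| ^+ 2 <= M.
  elim: n => [//|n IH] st; apply: quotient_l2 (a1 n) (st n (ltnSn n)) _.
  by apply: IH => i /ltnW; exact: st.
have st n : blaschke_quotient (a n) (F n) (F n.+1).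
  elim/ltn_ind: n => n IH; have F0 := l2_null _ _ (l2 n IH).
  have [C FC] := null_seq_bounded _ F0.
  have ev0 : evalq (a n) (F n) = 0.
    have := orth n; rewrite (H2_inner_MT _ F _ _ C)// => /eqP.
    rewrite scaler_eq0 sqrtr_eq0 leNgt subr_gt0 expr_lt1// a1 /= => /eqP; exact.
  have [x' xs] := quotient_div _ _ (a1 n) F0 ev0.
  exact: (@xgetPex _ (fun=> 0) [set x' | blaschke_quotient (a n) (F n) x'] (ex_intro _ x' xs)).
move=> m; apply: (quotient_vanish a F (M + 1) a1 div st _ m 0%N) => n k.
have : `|F n k| ^+ 2 <= M.
  apply: le_trans (l2 n (fun i _ => st i) k.+1).
  by rewrite big_ord_recr/= lerDr sumr_ge0// => i _; rewrite exprn_ge0.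
by have := normr_ge0 (F n k); nra.
Qed.

End Completeness.

Theorem theorem4p2 (R : realType) (a : nat -> quat R)
    (ha : forall n : nat, `|a n| < 1)
    (hdiv : (\sum_(n <oo) (1 - `|a n|)%:E)%E = +oo%E) :
  complete_in_H2 (MT a).
Proof.
move=> f fH2 orth q q1.
have div : forall n B, exists N, B <= \sum_(k < N) (1 - `|a (n + k)%N|).
  by apply: nneseries_tail_unbounded hdiv => n; rewrite subr_ge0 ltW.
have f0 := MT_orthogonal_eq0 a f ha div fH2 orth.
have [M fx _] := H2_coefs f fH2.
rewrite -(power_seriesE _ _ _ fx q1); apply: cvg_lim; first exact: norm_hausdorff.
rewrite (_ : series _ = cst 0); first exact: cvg_cst.
by apply/funext => n; apply: big1 => k _; rewrite f0 mulr0.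
Qed.
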